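(* Let $0<\rho\le1$ and $-1<\mu,\upsilon\le-\frac12$. Let $f\in B_{\mu,\upsilon}^{1,\rho}(J)$ and suppose that $f(\xi)=0$ for some point $\xi\in[0,1]$. Then $$\|f\|_\infty\le\sqrt2\;\|f\|_{0,\varkappa^{\mu,\upsilon,\rho}}^{1/2}\;\|\partial_tf\|_{0,\tilde\varkappa^{\mu,\upsilon,\rho}}^{1/2}.$$
   Context: $J=[0,1]$ and $\|\cdot\|_\infty$ is the supremum norm on $J$. The weights are $\varkappa^{a,b,\rho}(t)=\rho(1-t)^{\rho(a+1)-1}\bigl(1-(1-t)^\rho\bigr)^b$ and $\tilde\varkappa^{\mu,\upsilon,\rho}(t)=\rho^{-1}(1-t)^{\rho\mu+1}\bigl(1-(1-t)^\rho\bigr)^{\upsilon+1}$. For a weight $\varkappa$, $\|f\|_{0,\varkappa}=(\int_0^1f^2\varkappa\,dt)^{1/2}$ and $L^2_\varkappa(J)$ is the associated space. $\mathcal{D}_\rho f(t)=\frac{(1-t)^{1-\rho}}{\rho}f'(t)$. $B_{\mu,\upsilon}^{1,\rho}(J)=\{f:\ f\in L^2_{\varkappa^{\mu,\upsilon,\rho}}(J),\ \mathcal{D}_\rho f\in L^2_{\varkappa^{\mu+1,\upsilon+1,\rho}}(J)\}$ (weak derivatives; elements are identified with their continuous representatives on $J$). *)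

(* Defs.v *)
From HB Require Import structures.
From mathcomp Require Import all_boot all_order all_algebra.
From mathcomp Require Import all_classical all_reals all_analysis.

Set Implicit Arguments.
Unset Strict Implicit.
Unset Printing Implicit Defensive.

Import Order.TTheory GRing.Theory Num.Theory.
Import numFieldNormedType.Exports.

Local Open Scope classical_set_scope.
Local Open Scope ring_scope.

(* The real power [powR] maps base 0 to 0 for every nonzero exponent, so both
   weights are total on [0,1]; the values at the endpoints, where the actual
   weights may be singular, sit on a Lebesgue-null set. *)
Definition kappa (R : realType) (a b rho : R) (t : R) : R :=
  rho * (1 - t) `^ (rho * (a + 1) - 1) * (1 - (1 - t) `^ rho) `^ b.

Definition kappat (R : realType) (mu ups rho : R) (t : R) : R :=
  rho^-1 * (1 - t) `^ (rho * mu + 1) * (1 - (1 - t) `^ rho) `^ (ups + 1).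

Definition wnorm (R : realType) (w f : R -> R) : \bar R :=
  ((\int[lebesgue_measure]_(t in `[0%R, 1%R]) (f t ^+ 2 * w t)%:E) `^ 2^-1)%E.

Definition L2w (R : realType) (w : R -> R) : set (R -> R) :=
  [set f : R -> R | measurable_fun (`[0, 1] : set R) f /\ (wnorm w f < +oo)%E].

Definition supnorm (R : realType) (f : R -> R) : \bar R :=
  ereal_sup [set `|f t|%:E | t in `[0, 1]].

(* C_c^oo(]0,1[); elements are extended by 0 to the whole line. *)
Definition test_function (R : realType) : set (R -> R) :=
  [set phi : R -> R | (forall (n : nat) (x : R), derivable (derive1n n phi) x 1) /\
    exists a b : R, [/\ 0 < a, b < 1 &
      forall x, x \notin `[a, b] -> phi x = 0]].

Definition is_weak_derivative (R : realType) (f g : R -> R) : Prop :=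
  [/\ locally_integrable `]0, 1[ f, locally_integrable `]0, 1[ g &
    forall phi, test_function phi ->
      \int[lebesgue_measure]_(t in `]0, 1[) (f t * derive1 phi t) =
      - \int[lebesgue_measure]_(t in `]0, 1[) (g t * phi t)].

(* D_rho f, as a function of the (weak) derivative df of f. *)
Definition Drho (R : realType) (rho : R) (df : R -> R) (t : R) : R :=
  (1 - t) `^ (1 - rho) / rho * df t.

(* The continuity clause selects the continuous representative on [0,1];
   values of f outside [0,1] are irrelevant. *)
Definition Brho (R : realType) (mu ups rho : R) : set (R -> R) :=
  [set f : R -> R | [/\ {within `[0, 1], continuous f},
    L2w (kappa mu ups rho) f &
    exists2 df, is_weak_derivative f df &
      L2w (kappa (mu + 1) (ups + 1) rho) (Drho rho df)]].

(* Main.v *)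
Require Import Defs.
From HB Require Import structures.
From mathcomp Require Import all_boot all_order all_algebra.
From mathcomp Require Import all_classical all_reals all_analysis.
From mathcomp Require Import measurable_realfun ring lra.

(* Testing the weak derivative against smooth plateaus supported in [[a, b]]
   gives [|f b - f a| <= \int_a^b |f'|]; cutting [[a, b]] into pieces on which f
   oscillates little, this yields [|f(b)^2 - f(a)^2| <= 2 \int_a^b |f| |f'|].
   Since mu, ups <= -1/2, the two weights have product at least 1 on ]0, 1[, so
   Cauchy-Schwarz bounds the right-hand side by twice the product of the weighted
   norms. By continuity a may be taken to be the zero xi, even at an endpoint. *)

Set Implicit Arguments.
Unset Strict Implicit.
Unset Printing Implicit Defensive.

Import Order.TTheory GRing.Theory Num.Theory.
Import numFieldNormedType.Exports.

Local Open Scope classical_set_scope.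
Local Open Scope ring_scope.

(** * Iterated differentiability and its closure rules *)

(** The recursion peels off the innermost derivative, so an induction on [n] passes from [f] to
    [derive1 f]; having it for every [n] is the smoothness asked of test functions. *)
Fixpoint Cder (R : realType) (n : nat) (f : R -> R) : Prop :=
  if n is m.+1 then (forall x, derivable f x 1) /\ Cder m (derive1 f) else True.

Lemma Cder_derivable1n (R : realType) n (f : R -> R) (x : R) :
  Cder n.+1 f -> derivable (derive1n n f) x 1.
Proof.
elim: n f => [|n IH] f; first by case.
by move=> [_ /IH]; rewrite /derive1n iterSr.
Qed.

Lemma CderW (R : realType) n (f : R -> R) : Cder n.+1 f -> Cder n f.
Proof. by elim: n f => // n IH f [df /IH]. Qed.

(** Lets each closure rule below exhibit a derivative in closed form and recurse on that formula. *)
Lemma CderS (R : realType) n (f g : R -> R) :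
  (forall x : R, is_derive x 1 f (g x)) -> Cder n g -> Cder n.+1 f.
Proof.
move=> fg cg; split; first by move=> x; apply: ex_derive.
by have -> : (derive1 f) = g by apply/funext => x; rewrite derive1E derive_val.
Qed.

Lemma Cder_cst (R : realType) n (c : R) : Cder n (cst c).
Proof.
elim: n c => // n IH c.
by apply: (@CderS _ _ _ (cst 0)) => // x; exact: is_derive_cst.
Qed.

Lemma Cder_is_derive (R : realType) n (f : R -> R) (x : R) :
  Cder n.+1 f -> is_derive x 1 f ((derive1 f) x).
Proof. by move=> [df _]; rewrite derive1E; exact: derivableP. Qed.

Lemma CderD (R : realType) n (f g : R -> R) :
  Cder n f -> Cder n g -> Cder n (f \+ g).
Proof.
elim: n f g => // n IH f g cf cg.
apply: (@CderS _ _ _ ((derive1 f) \+ (derive1 g))) => [x|]; last first.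
  by apply: IH; [case: cf|case: cg].
exact: (is_deriveD (Cder_is_derive x cf) (Cder_is_derive x cg)).
Qed.

Lemma CderM (R : realType) n (f g : R -> R) :
  Cder n f -> Cder n g -> Cder n (f \* g).
Proof.
elim: n f g => // n IH f g cf cg.
apply: (@CderS _ _ _ ((f \* (derive1 g)) \+ (g \* (derive1 f)))) => [x|]; last first.
  by apply: CderD; apply: IH; try exact: CderW; [case: cg|case: cf].
exact: (is_deriveM (Cder_is_derive x cf) (Cder_is_derive x cg)).
Qed.

(** The derivative [- f' / f ^ 2] is a product of constants, [f'] and copies of [1 / f], and the
    induction hypothesis already covers [1 / f] one order lower. *)
Lemma CderV (R : realType) n (f : R -> R) :
  (forall x, f x != 0) -> Cder n f -> Cder n (fun x => (f x)^-1).
Proof.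
move=> f0; elim: n => // n IH cf; have IHf := IH (CderW cf).
pose g : R -> R := (cst (-1)) \* (((fun x => (f x)^-1) \* (fun x => (f x)^-1)) \* (derive1 f)).
apply: (@CderS _ _ _ g) => [x|]; last first.
  apply: CderM; first exact: Cder_cst.
  by apply: CderM; [exact: CderM|case: cf].
have -> : g x = - (f x) ^- 2 *: (derive1 f) x.
  by rewrite /g /= /GRing.scale /= mulN1r mulNr -expr2 exprVn.
exact: (is_deriveV (f0 x) (Cder_is_derive x cf)).
Qed.

Lemma is_derive_affine (R : realType) (f : R -> R) (a b x d : R) :
  is_derive (a * x + b) 1 f d ->
  is_derive x 1 (fun t => f (a * t + b)) (d * a).
Proof.
move=> fd; apply: (@is_derive1_comp _ f (fun t => a * t + b)).
apply: is_derive_eq.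
by rewrite addr0; exact: mulr1.
Qed.

Lemma Cder_affine (R : realType) n (f : R -> R) (a b : R) :
  Cder n f -> Cder n (fun t => f (a * t + b)).
Proof.
elim: n f => // n IH f cf.
apply: (@CderS _ _ _ ((fun t => (derive1 f) (a * t + b)) \* cst a)) => [x|].
  exact: (is_derive_affine (Cder_is_derive _ cf)).
by apply: CderM; [apply: IH; case: cf|exact: Cder_cst].
Qed.

(** * The functions vanishing to infinite order at 0 *)

(** For [k = 0] this is the classical [exp (-1/x)], extended by 0. The factor [x ^- k] makes the
    span of the family stable under differentiation. *)
Definition flat (R : realType) (k : nat) (x : R) : R :=
  if 0 < x then x ^- k * expR (- x^-1) else 0.

(** With [u = 1/x], the exponential series gives [u ^ (k+2) / (k+2)! <= exp u]. The spare power
    [x ^ 2] makes the difference quotient at 0 tend to 0. *)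
Lemma flat_le (R : realType) k (x : R) : 0 < x ->
  flat k x <= k.+2`!%:R * x ^+ 2.
Proof.
move=> x0; rewrite /flat x0 expRN -[leRHS]mulr1.
have u0 : 0 <= x^-1 by rewrite invr_ge0 ltW.
have := expR_ge1Dxn k.+1 u0; set E := expR _ => hE.
have E0 : 0 < E by exact: expR_gt0.
rewrite ler_pdivrMr// mulr1.
have {}hE : x^-1 ^+ k.+2 <= k.+2`!%:R * E.
  rewrite mulrC -ler_pdivrMr ?ltr0n ?fact_gt0//.
  by apply: le_trans hE; rewrite lerDr.
rewrite -mulrA [_ * E]mulrC mulrA -ler_pdivrMr ?exprn_gt0//.
by apply: le_trans hE; rewrite -exprVn -[x ^- 2]exprVn -exprD addn2.
Qed.

Lemma flat_ge0 (R : realType) k (x : R) : 0 <= flat k x.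
Proof.
rewrite /flat; case: ifPn => // x0.
by rewrite mulr_ge0 ?expR_ge0// invr_ge0 exprn_ge0// ltW.
Qed.

Lemma is_derive_flat0 (R : realType) k : is_derive (0 : R) 1 (flat k) 0.
Proof.
have h : (fun h : R => h^-1 *: (flat k (h *: 1 + 0) - flat k 0)) @ 0^' --> (0 : R).
  pose C : R := k.+2`!%:R.
  have C0 : 0 < C by rewrite ltr0n fact_gt0.
  apply/cvgrPdist_le => e e0; near=> h.
  have h0 : h != 0 by near: h; exact: nbhs_dnbhs_neq.
  rewrite sub0r normrN /GRing.scale/= mulr1 addr0 {2}/flat ltxx subr0.
  rewrite normrM normfV ler_pdivrMl ?normr_gt0// ger0_norm ?flat_ge0//.
  have hC : `|h| <= e / C.
    near: h; apply: dnbhs0_le; exact: divr_gt0.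
  have [hp|hn] := ltP 0 h; last by rewrite /flat ltNge hn/= mulr_ge0// ltW.
  apply: le_trans (flat_le k hp) _; rewrite expr2 mulrCA gtr0_norm//.
  rewrite ler_pM2l// mulrC -ler_pdivlMr//.
  by rewrite gtr0_norm in hC.
apply: DeriveDef; last exact: (cvg_lim _ h).
by apply/cvg_ex; exists 0; exact: h.
Unshelve. all: by end_near. Qed.

(** Off 0, [flat] agrees locally with 0 or with [x ^- k * exp (-1/x)], to which the product rule
    applies; at 0 both terms vanish and the quadratic bound takes over. *)
Lemma is_derive_flat (R : realType) k (x : R) :
  is_derive x 1 (flat k) (flat k.+2 x - k%:R * flat k.+1 x).
Proof.
have [x0|x0|->] := ltgtP x 0.
- rewrite /flat !(ltNge 0 x) ltW//= mulr0 subr0.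
  apply: (@near_eq_is_derive _ _ _ (cst 0)).
  near=> t; rewrite ltNge ifF//; apply/negbF/ltW; near: t.
  exact: lt_nbhsl.
- have xn0 : x != 0 by rewrite gt_eqF.
  have dV : is_derive x 1 (fun t : R => t^-1) (- x ^- 2).
    have := @is_deriveV _ id x 1 1 xn0 (is_derive_id _ _).
    by rewrite /GRing.scale/= mulr1.
  have dX : is_derive x 1 (fun t : R => t ^- k) (k%:R * x^-1 ^+ k.-1 * - x ^- 2).
    have -> : (fun t : R => t ^- k) = (fun t => t^-1) ^+ k.
      by apply/funext => t; rewrite fctE exprVn.
    exact: (@is_deriveX _ _ (fun t : R => t^-1) k x 1 _ dV).
  have dE : is_derive x 1 (fun t : R => expR (- t^-1)) (expR (- x^-1) * x ^- 2).
    apply: (@is_derive1_comp _ expR (fun t => - t^-1)).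
    by have := is_deriveN dV; rewrite opprK.
  have d : is_derive x 1 (fun t => t ^- k * expR (- t^-1)) (flat k.+2 x - k%:R * flat k.+1 x).
    apply: (is_derive_eq (is_deriveM dX dE)).
    rewrite /flat x0 /GRing.scale/= -!exprVn.
    set E := expR _; set u := x^-1.
    (* The power rule carries the exponent [k.-1], so [k = 0] is treated apart. *)
    case: k {dX} => [|k] /=; rewrite ?mul0r ?mulr0 !exprS; ring.
  apply: near_eq_is_derive d.
  by near=> t; rewrite /flat ifT//; near: t; exact: lt_nbhsr.
- have := is_derive_flat0 R k; rewrite /flat !ltxx mulr0 subr0; exact.
Unshelve. all: by end_near. Qed.

Lemma Cder_flat (R : realType) n k : Cder n (@flat R k).
Proof.
elim: n k => // n IH k.
apply: (@CderS _ _ _ (flat k.+2 \+ (cst (- k%:R) \* flat k.+1))) => [x|].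
  by have := is_derive_flat k x; rewrite -mulNr.
by apply: CderD => //; apply: CderM => //; exact: Cder_cst.
Qed.

Lemma flat_eq0 (R : realType) k (x : R) : x <= 0 -> flat k x = 0.
Proof. by rewrite /flat leNgt => /negbTE ->. Qed.

Lemma flat_gt0 (R : realType) k (x : R) : 0 < x -> 0 < flat k x.
Proof.
by move=> x0; rewrite /flat x0 mulr_gt0 ?expR_gt0// invr_gt0 exprn_gt0.
Qed.

(** * Smooth step and cutoff functions *)

(** The step is [F x / (F x + F (1 - x))] with [F = flat 0]; the denominator is positive since [x]
    and [1 - x] are never both nonpositive. *)
Lemma smooth_step (R : realType) : exists s : R -> R,
  [/\ forall n, Cder n s, forall x, 0 <= s x <= 1,
      (forall x, x <= 0 -> s x = 0) /\ (forall x, 1 <= x -> s x = 1),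
      forall x, 0 <= derive1 s x &
      forall x, (x <= 0) || (1 <= x) -> derive1 s x = 0].
Proof.
pose r (x : R) := flat 0 (-1 * x + 1).
have rE x : r x = flat 0 (1 - x) by rewrite /r mulN1r addrC.
pose D := flat 0 \+ r.
have D0 x : 0 < D x.
  rewrite /D /= rE; have [x0|x0] := ltP 0 x.
    by rewrite ltr_pwDl ?flat_gt0 ?flat_ge0.
  by rewrite ltr_wpDl ?flat_gt0 ?flat_ge0// subr_gt0 (le_lt_trans x0).
have Dn0 x : D x != 0 by rewrite gt_eqF.
pose s := flat 0 \* (fun x => (D x)^-1).
(* The quotient rule after cancellation, [flat 2] being the derivative of [flat 0]. In this form the
   sign of the derivative and its vanishing off []0, 1[] can be read off. *)
pose g (x : R) := (flat 2 x * flat 0 (1 - x) + flat 0 x * flat 2 (1 - x)) / D x ^+ 2.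
have dr (x : R) : is_derive x 1 r (- flat 2 (1 - x)).
  have := is_derive_affine (is_derive_flat 0 (-1 * x + 1)).
  by rewrite mul0r subr0 mulrN1 mulN1r [- x + 1]addrC.
have ds (x : R) : is_derive x 1 s (g x).
  have d0 : is_derive x 1 (flat 0) (flat 2 x).
    by have := is_derive_flat 0 x; rewrite mul0r subr0.
  apply: (is_derive_eq (is_deriveM d0 (is_deriveV (Dn0 x) (is_deriveD d0 (dr x))))).
  rewrite /g /GRing.scale/= -rE.
  have -> : r x = D x - flat 0 x by rewrite /D/= addrC addKr.
  field; exact: Dn0.
have s'E x : derive1 s x = g x by rewrite derive1E; exact: derive_val.
exists s; split=> [n|x||x|x].
- apply: CderM; first exact: Cder_flat.
  apply: CderV => //; apply: CderD; first exact: Cder_flat.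
  by apply: Cder_affine; exact: Cder_flat.
- rewrite /s/= divr_ge0 ?flat_ge0 ?(ltW (D0 _))//= ler_pdivrMr// mul1r.
  by rewrite /D/= lerDl rE flat_ge0.
- split=> x hx; rewrite /s/=; first by rewrite flat_eq0// mul0r.
  have r0 : r x = 0 by rewrite rE flat_eq0// subr_le0.
  have : D x = flat 0 x by rewrite /D/= r0 addr0.
  by move=> <-; rewrite divff.
- by rewrite s'E /g divr_ge0 ?sqr_ge0// addr_ge0 ?mulr_ge0 ?flat_ge0.
- rewrite s'E /g => /orP[x0|x1].
    by rewrite !(flat_eq0 _ x0) !mul0r addr0 mul0r.
  by rewrite !(@flat_eq0 _ _ (1 - x)) ?subr_le0// !mulr0 addr0 mul0r.
Qed.

(* [p] and [q] are the rise and fall of the cutoff. *)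
Lemma cutoff (R : realType) (a b d : R) :
  0 < a -> b < 1 -> 0 < d -> d <= b - a ->
  exists phi p q : R -> R,
  [/\ test_function phi,
      (forall t, `|phi t| <= 1) /\ (forall t, t \notin `[a, b] -> phi t = 0),
      forall t, derive1 phi t = p t - q t,
      [/\ continuous p, forall t, 0 <= p t,
          forall t, t \notin `[a, a + d] -> p t = 0 &
          \int[lebesgue_measure]_(t in `]0, 1[) p t = 1] &
      [/\ continuous q, forall t, 0 <= q t,
          forall t, t \notin `[b - d, b] -> q t = 0 &
          \int[lebesgue_measure]_(t in `]0, 1[) q t = 1]].
Proof.
move=> a0 b1 d0 dab; have [s [cs s01 [s0 s1] s'0 s'01]] := smooth_step R.
have dV0 : 0 < d^-1 by rewrite invr_gt0.
(* [S c] is the step rescaled to climb from 0 to 1 on [[c, c + d]], written as an affine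
   substitution; [S' c] is its derivative. *)
pose S c t := s (d^-1 * t + - (d^-1 * c)).
pose S' c t := derive1 s (d^-1 * t + - (d^-1 * c)) * d^-1.
have SE c t : d^-1 * t + - (d^-1 * c) = (t - c) / d by rewrite mulrC; ring.
have dS c (t : R) : is_derive t 1 (S c) (S' c t).
  exact: (is_derive_affine (Cder_is_derive _ (cs 1%N))).
have cS' c : continuous (S' c).
  have c2 : Cder 1 (S' c).
    apply: CderM; last exact: Cder_cst.
    by apply: (@Cder_affine _ _ (derive1 s)); case: (cs 2%N).
  move=> t; apply/differentiable_continuous; rewrite -derivable1_diffP.
  by case: c2.
have S0 c t : t <= c -> S c t = 0.
  by move=> tc; rewrite /S SE s0// pmulr_lle0 ?subr_le0.
have S1 c t : c + d <= t -> S c t = 1.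
  by move=> tc; rewrite /S SE s1// ler_pdivlMr// mul1r lerBrDl.
have S'pos c t : 0 <= S' c t by rewrite mulr_ge0// ltW.
have S'0 c t : t \notin `[c, c + d] -> S' c t = 0.
  rewrite in_itv/= negb_and -!ltNge => ht; rewrite /S' SE s'01 ?mul0r//.
  apply/orP; case/orP: ht => ht; [left|right].
    by rewrite pmulr_lle0// subr_le0 ltW.
  by rewrite ler_pdivlMr// mul1r lerBrDl ltW.
have IS' c : 0 < c -> c + d < 1 ->
    \int[lebesgue_measure]_(t in `]0, 1[) S' c t = 1.
  move=> c0 c1; rewrite /Rintegral.
  rewrite -(@integral_itv_bndoo _ _ _ _ true false); last first.
    apply/measurable_EFinP; apply: measurable_funTS; exact: continuous_measurable_fun.
  rewrite (@continuous_FTC2 _ _ (S c))//.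
  - by rewrite (S0 c 0) ?(S1 c 1) ?ltW// -EFinB subr0.
  - exact: continuous_subspaceT.
  - split.
    + by move=> t _; exact: ex_derive.
    + apply: cvg_at_right_filter.
      by apply/differentiable_continuous; rewrite -derivable1_diffP; exact: ex_derive.
    + apply: cvg_at_left_filter.
      by apply/differentiable_continuous; rewrite -derivable1_diffP; exact: ex_derive.
  - by move=> t _; rewrite derive1E derive_val.
(* The ramps may overlap, but [d <= b - a] makes both equal to 0 left of [a] and both equal to 1
   right of [b]. As a difference of values in [[0, 1]], [phi] stays within [[-1, 1]]. *)
pose phi := S a \- S (b - d).
have phi0 t : t \notin `[a, b] -> phi t = 0.
  rewrite in_itv/= negb_and -!ltNge /phi/= => /orP[ta|bt].
    rewrite !S0 ?subr0 ?(ltW ta)//; lra.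
  by rewrite !S1 ?subrr//; lra.
exists phi, (S' a), (S' (b - d)); split.
- split.
    move=> n x; apply: Cder_derivable1n; rewrite /phi.
    have -> : S a \- S (b - d) = S a \+ (cst (-1) \* S (b - d)).
      by apply/funext => t /=; rewrite mulN1r.
    apply: CderD; last (apply: CderM; first exact: Cder_cst).
      exact: Cder_affine.
    exact: Cder_affine.
  by exists a, b.
- split=> // t; rewrite /phi/= ler_norml.
  have /andP[? ?] := s01 (d^-1 * t + - (d^-1 * a)).
  have /andP[? ?] := s01 (d^-1 * t + - (d^-1 * (b - d))).
  by rewrite /S; apply/andP; split; lra.
- by move=> t; rewrite derive1E; have := is_deriveB (dS a t) (dS (b - d) t) => ?; exact: derive_val.
- by split=> //; [exact: S'0|apply: IS'; lra].
- split=> //; last by apply: IS'; lra.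
  by move=> t ht; apply: S'0; rewrite subrK.
Qed.

(** * Increment bounds from the weak derivative *)

Lemma within_continuousM (R : realType) (A : set R) (f g : R -> R) :
  {within A, continuous f} -> {within A, continuous g} ->
  {within A, continuous (f \* g)}.
Proof. by move=> cf cg x; apply: continuousM; [exact: cf|exact: cg]. Qed.

Lemma continuous_integrable_oo01 (R : realType) (f : R -> R) :
  {within `[0, 1], continuous f} ->
  lebesgue_measure.-integrable (`]0, 1[ : set R) (EFin \o f).
Proof.
move=> cf.
have icc : lebesgue_measure.-integrable (`[0, 1] : set R) (EFin \o f).
  by apply: continuous_compact_integrable => //; exact: segment_compact.
by apply: integrableS icc => //; exact: subset_itv_oo_cc.
Qed.

Lemma integrable_locally_integrable (R : realType) (g : R -> R) (a b : R) :
  locally_integrable `]0, 1[ g -> 0 < a -> b < 1 ->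
  lebesgue_measure.-integrable (`[a, b] : set R) (EFin \o g).
Proof.
move=> [mg _ ig] a0 b1.
have ab01 : (`[a, b] : set R) `<=` `]0, 1[.
  by move=> t /=; rewrite !in_itv/= => /andP[? ?]; apply/andP; split; lra.
apply/integrableP; split.
  by apply/measurable_EFinP; exact: measurable_funS mg.
by apply: ig => //; exact: segment_compact.
Qed.

(** For a cutoff with [phi' = p - q], the integral of [f * (p - q)] is within [e] of [f a - f b],
    because [p] and [q] are unit masses concentrated near [a] and [b]. By the weak derivative it is
    also minus the integral of [df * phi], where [phi] is bounded by 1 and lives on [[a, b]]. *)
Lemma weak_derivative_increment (R : realType) (f df : R -> R) (a b : R) :
  {within `[0, 1], continuous f} -> is_weak_derivative f df ->
  0 < a -> a < b -> b < 1 ->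
  `|f b - f a| <= \int[lebesgue_measure]_(t in `[a, b]) `|df t|.
Proof.
move=> cf [_ ldf wdf] a0 ab b1; set K := \int[_]_(_ in _) _.
have [cf01 _ _] := (continuous_within_itvP f (@ltr01 R)).1 cf.
apply/ler_addgt0Pr => e e0.
have e20 : 0 < e / 2 by rewrite divr_gt0.
have [d [d0 dab da db]] : exists d, [/\ 0 < d, d <= b - a,
    forall t, t \in `[a, a + d] -> `|f a - f t| <= e / 2 &
    forall t, t \in `[b - d, b] -> `|f b - f t| <= e / 2].
  have near_cont c : c \in `]0, 1[ ->
      exists2 r, 0 < r & forall t, `|c - t| < r -> `|f c - f t| <= e / 2.
    move=> /cf01 /cvgrPdist_le /(_ _ e20) [r /= r0 hr].
    by exists r => // t ht; exact: hr.
  have [|ra ra0 hra] := near_cont a; first by rewrite in_itv/=; lra.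
  have [|rb rb0 hrb] := near_cont b; first by rewrite in_itv/=; lra.
  (* The bound [b - a] is what the cutoff requires; halving the radii turns the closed conditions on
     [t] into strict ones. *)
  exists (Num.min (b - a) (Num.min ra rb / 2)); set m := Num.min ra rb.
  have m0 : 0 < m by rewrite lt_min ra0.
  have mra : m <= ra by rewrite ge_min lexx.
  have mrb : m <= rb by rewrite ge_min lexx orbT.
  set d := Num.min _ _.
  have dm : d <= m / 2 by rewrite ge_min lexx orbT.
  split.
  - by rewrite lt_min subr_gt0 ab divr_gt0.
  - by rewrite ge_min lexx.
  - move=> t; rewrite in_itv/= => /andP[h1 h2]; apply: hra.
    by rewrite ltr_norml; apply/andP; split; lra.
  - move=> t; rewrite in_itv/= => /andP[h1 h2]; apply: hrb.
    by rewrite ltr_norml; apply/andP; split; lra.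
have [phi [p [q [tphi [phi1 phi0] phi' [cp p0 pout ip] [cq q0 qout iq]]]]] :=
  cutoff a0 b1 d0 dab.
pose I := \int[lebesgue_measure]_(t in `]0, 1[) (f t * (p t - q t)).
pose J := \int[lebesgue_measure]_(t in `]0, 1[) (df t * phi t).
have IJ : I = - J.
  rewrite -(wdf phi tphi); congr Rintegral.
  by apply/funext => t; rewrite phi'.
have intc c (g : R -> R) : continuous g ->
    lebesgue_measure.-integrable (`]0, 1[ : set R) (EFin \o (fun t => c * g t)).
  move=> cg; apply: continuous_integrable_oo01; apply: continuous_subspaceT => t.
  by apply: continuousM; [exact: cvg_cst|exact: cg].
have intf : lebesgue_measure.-integrable (`]0, 1[ : set R)
    (EFin \o (fun t => f t * (p t - q t))).
  apply: continuous_integrable_oo01; apply: within_continuousM => //.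
  by apply: continuous_subspaceT => t; apply: continuousB; [exact: cp|exact: cq].
have intcB c c' : lebesgue_measure.-integrable (`]0, 1[ : set R)
    (EFin \o (fun t => c * p t - c' * q t)).
  by apply: eq_integrable (integrableB _ (intc c _ cp) (intc c' _ cq)).
have IcB c c' : \int[lebesgue_measure]_(t in `]0, 1[) (c * p t - c' * q t) = c - c'.
  rewrite RintegralB//; [|exact: intc|exact: intc].
  have int1 (g : R -> R) : continuous g ->
      lebesgue_measure.-integrable (`]0, 1[ : set R) (EFin \o g).
    by move=> cg; apply: continuous_integrable_oo01; exact: continuous_subspaceT.
  by rewrite !RintegralZl ?ip ?iq ?mulr1//; exact: int1.
(* On the support of [p], [f] is within [e / 2] of [f a], and likewise for [q] and [f b], so the
   integrand compares pointwise with some [c * p - c' * q], of integral [c - c']. *)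
have Ige : f a - e / 2 - (f b + e / 2) <= I.
  rewrite -IcB; apply: le_Rintegral => // t _; rewrite mulrBr lerB//.
  - have [ht|ht] := boolP (t \in `[a, a + d]); last by rewrite pout ?mulr0.
    rewrite ler_wpM2r//; have := da t ht; rewrite ler_norml; lra.
  - have [ht|ht] := boolP (t \in `[b - d, b]); last by rewrite qout ?mulr0.
    rewrite ler_wpM2r//; have := db t ht; rewrite ler_norml; lra.
have Ile : I <= f a + e / 2 - (f b - e / 2).
  rewrite -IcB; apply: le_Rintegral => // t _; rewrite mulrBr lerB//.
  - have [ht|ht] := boolP (t \in `[a, a + d]); last by rewrite pout ?mulr0.
    rewrite ler_wpM2r//; have := da t ht; rewrite ler_norml; lra.
  - have [ht|ht] := boolP (t \in `[b - d, b]); last by rewrite qout ?mulr0.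
    rewrite ler_wpM2r//; have := db t ht; rewrite ler_norml; lra.
suff JK : `|J| <= K.
  by move: JK; rewrite !ler_norml; lra.
have idf := integrable_locally_integrable ldf a0 b1.
have mphi : measurable_fun setT phi.
  apply: continuous_measurable_fun => t; apply/differentiable_continuous.
  by rewrite -derivable1_diffP; exact: (tphi.1 0%N).
have ab01 : (`[a, b] : set R) `<=` `]0, 1[.
  by move=> t /=; rewrite !in_itv/= => /andP[? ?]; apply/andP; split; lra.
(* Since [df] is only locally integrable on []0, 1[], the dominating function is [|df|] cut off to
   [[a, b]]. *)
have KE : K = \int[lebesgue_measure]_(t in `]0, 1[) ((fun t => `|df t|) \_ `[a, b]) t.
  by rewrite -Rintegral_mkcondr setIidr.
have idfr : lebesgue_measure.-integrable (`]0, 1[ : set R)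
    (EFin \o ((fun t => `|df t|) \_ `[a, b])).
  rewrite -restrict_EFin; apply/integrable_restrict => //=.
  by rewrite setIidr//; exact: integrable_abse idf.
have dfphi t : `|df t * phi t| <= ((fun t => `|df t|) \_ `[a, b]) t.
  rewrite patchE; case: ifPn => [tab|tab].
    by rewrite normrM ler_piMr.
  rewrite phi0 ?mulr0 ?normr0//.
  by apply: contra tab => ?; rewrite inE.
have idfphi : lebesgue_measure.-integrable (`]0, 1[ : set R)
    (EFin \o (fun t => df t * phi t)).
  apply: le_integrable idfr => //.
    apply/measurable_EFinP; apply: measurable_funM; last exact: measurable_funTS.
    by case: ldf.
  move=> t _ /=; rewrite lee_fin; apply: le_trans (dfphi t) _; exact: ler_norm.
apply: le_trans (le_normr_Rintegral _ idfphi) _ => //.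
rewrite KE; apply: le_Rintegral => //.
exact: (integrable_abse idfphi).
Qed.

(* Local-to-global passage for interval-additive bounds, by the supremum of
   the points reached from [a]. *)
Lemma increment_le (R : realType) (g G : R -> R) (a b : R) : a <= b ->
  (forall x, a <= x <= b -> exists2 r, 0 < r & forall u v,
     a <= u -> v <= b -> u <= v -> x - r < u -> v < x + r ->
     `|g v - g u| <= G v - G u) ->
  `|g b - g a| <= G b - G a.
Proof.
move=> ab loc.
pose S : set R := [set x | a <= x <= b /\ `|g x - g a| <= G x - G a].
have Sa : S a by split; rewrite ?lexx ?ab// !subrr normr0.
have hS : has_sup S by split; [exists a|exists b => x [/andP[]]].
have sa : a <= sup S by exact: sup_upper_bound.
have sb : sup S <= b by apply: ge_sup; [exists a|move=> x [/andP[]]].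
have [|r r0 hr] := loc (sup S); first by rewrite sa.
have [u [/andP[au ub] gu] su] := sup_adherent r0 hS.
have us : u <= sup S by apply: sup_upper_bound => //; split => //; rewrite au.
(* The local bound leads from [u], just left of [sup S], to [v], so [v] lies in [S]. Either [v = b],
   which is the claim, or [v] exceeds [sup S], which is absurd. *)
pose v := Num.min b (sup S + r / 2).
have uv : u <= v by rewrite le_min ub (le_trans us)// lerDl divr_ge0// ltW.
have vb : v <= b by rewrite ge_min lexx.
have vs : v <= sup S + r / 2 by rewrite ge_min lexx orbT.
have Sv : S v.
  split; first by rewrite vb (le_trans au).
  have := hr u v au vb uv su.
  rewrite (le_lt_trans vs) ?ltrD2l ?ltr_pdivrMr ?ltr_pMr ?ltr1n// => /(_ isT) h.
  rewrite -(subrKA (g u)); apply: le_trans (ler_normD _ _) _.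
  have -> : G v - G a = (G v - G u) + (G u - G a) by rewrite subrKA.
  exact: lerD.
have := sup_upper_bound hS Sv; rewrite {1}/v ge_min => /orP[bs|].
  by move: Sv.2; rewrite /v (min_idPl _)// (le_trans bs)// lerDl divr_ge0// ltW.
by rewrite gerDl leNgt divr_gt0.
Qed.

(** On a short [[u, v]], the factor [|f v + f u|] is at most [2 * |f t| + e] for each [t] in it, and
    [|f v - f u|] is at most the integral of [|df|]. Chaining such pieces leaves an excess of [e]
    times the integral of [|df|], with [e] arbitrary. *)
Lemma sqr_increment (R : realType) (f df : R -> R) (a b : R) :
  {within `[0, 1], continuous f} -> is_weak_derivative f df ->
  0 < a -> a <= b -> b < 1 ->
  lebesgue_measure.-integrable (`[a, b] : set R) (EFin \o (fun t => `|f t| * `|df t|)) /\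
  `|f b ^+ 2 - f a ^+ 2| <=
    2 * \int[lebesgue_measure]_(t in `[a, b]) (`|f t| * `|df t|).
Proof.
move=> cf wf a0 ab b1.
have [[mf _ _] ldf _] := wf.
have [cf01 _ _] := (continuous_within_itvP f (@ltr01 R)).1 cf.
have idf := integrable_locally_integrable ldf a0 b1.
have iadf : lebesgue_measure.-integrable (`[a, b] : set R) (EFin \o (fun t => `|df t|)).
  exact: (integrable_abse idf).
have ab01 : (`[a, b] : set R) `<=` `]0, 1[.
  by move=> t /=; rewrite !in_itv/= => /andP[? ?]; apply/andP; split; lra.
have [M M0 fM] : exists2 M, 0 <= M & forall t, t \in `[0, 1] -> `|f t| <= M.
  have [|c _ hc] := @EVT_max R (fun t => `|f t|) 0 1 ler01.
    by move=> t; apply: continuous_comp; [exact: cf|exact: norm_continuous].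
  by exists `|f c|.
have Zint c : lebesgue_measure.-integrable (`[a, b] : set R) (EFin \o (fun t => c * `|df t|)).
  by apply: eq_integrable (integrableZl _ c iadf).
have ifdf : lebesgue_measure.-integrable (`[a, b] : set R)
    (EFin \o (fun t => `|f t| * `|df t|)).
  apply: le_integrable (Zint M) => //.
    apply/measurable_EFinP; have [mdf _ _] := ldf.
    apply: measurable_funM; apply: measurableT_comp => //.
      exact: measurable_funS mf.
    exact: measurable_funS mdf.
  move=> t tab /=; rewrite lee_fin !normrM !normr_id ler_wpM2r//.
  rewrite ger0_norm// fM//; have := ab01 t tab; rewrite /= !in_itv/=; lra.
split=> //; set K := \int[_]_(t in _) _; set L := \int[lebesgue_measure]_(t in `[a, b]) `|df t|.
have L0 : 0 <= L by exact: Rintegral_ge0.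
suff H e : 0 < e -> `|f b ^+ 2 - f a ^+ 2| <= 2 * K + e * L.
  apply/ler_addgt0Pr => e e0.
  (* Dividing by [L + 1] rather than [L] covers [L = 0]. *)
  have L10 : 0 < L + 1 by rewrite ltr_wpDl.
  apply: le_trans (H (e / (L + 1)) _) _; first exact: divr_gt0.
  rewrite lerD2l -mulrA ler_piMr//; first exact: ltW.
  by rewrite mulrC ler_pdivrMr// mul1r lerDl.
move=> e0; pose w t := 2 * (`|f t| * `|df t|) + e * `|df t|.
have iw2 : lebesgue_measure.-integrable (`[a, b] : set R)
    (EFin \o (fun t => 2 * (`|f t| * `|df t|))).
  by apply: eq_integrable (integrableZl _ 2 ifdf).
have iw : lebesgue_measure.-integrable (`[a, b] : set R) (EFin \o w).
  by apply: eq_integrable (integrableD _ iw2 (Zint e)).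
have w0 t : 0 <= w t by rewrite addr_ge0// ?mulr_ge0// ltW.
(* The primitive of the perturbed integrand is the additive majorant for [increment_le]. *)
pose G x := \int[lebesgue_measure]_(t in `[a, x]) w t.
have Gb : G b = 2 * K + e * L.
  by rewrite /G RintegralD// !RintegralZl.
have Ga : G a = 0 by rewrite /G set_itv1 Rintegral_set1.
have GB u v : a <= u -> u <= v -> v <= b ->
    G v - G u = \int[lebesgue_measure]_(t in `[u, v]) w t.
  move=> au uv vb.
  have iav : lebesgue_measure.-integrable (`[a, v] : set R) (EFin \o w).
    by apply: integrableS iw => //; apply: subset_itvl; rewrite bnd_simp.
  rewrite /G Rintegral_itvB ?bnd_simp// Rintegral_itv_obnd_cbnd//.
  by apply: integrableS iav => //; apply: subset_itvr; rewrite bnd_simp.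
rewrite -Gb -[G b]subr0 -Ga.
apply: (@increment_le _ (fun x => f x ^+ 2) G) => // x /andP[ax xb].
have x01 : x \in `]0, 1[ by rewrite in_itv/=; lra.
(* [f v + f u] differs from [2 * f t] by four deviations from [f x], each at most [e / 4]. *)
have e40 : 0 < e / 4 by rewrite divr_gt0.
have /cvgrPdist_le /(_ _ e40) [r /= r0 hr] := cf01 x x01.
exists r => // u v au vb uv ru rv; rewrite GB//.
have [<-|nuv] := eqVneq u v.
  by rewrite subrr normr0; apply: Rintegral_ge0.
have ltuv : u < v by rewrite lt_neqAle nuv.
have inc := weak_derivative_increment cf wf (lt_le_trans a0 au) ltuv (le_lt_trans vb b1).
have suv : (`[u, v] : set R) `<=` `[a, b].
  by apply: subset_itvScc; rewrite bnd_simp.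
have iuv : lebesgue_measure.-integrable (`[u, v] : set R) (EFin \o (fun t => `|df t|)).
  exact: integrableS iadf.
rewrite subr_sqr normrM mulrC.
apply: (@le_trans _ _ (`|f v + f u| * \int[lebesgue_measure]_(t in `[u, v]) `|df t|)).
  by rewrite ler_wpM2l.
rewrite -RintegralZl//; apply: le_Rintegral => //.
- by apply: integrableS (Zint _) => //.
- exact: integrableS iw.
move=> t /=; rewrite in_itv/= => /andP[ut tv].
rewrite /w mulrA -mulrDl ler_wpM2r//.
have near_x z : u <= z -> z <= v -> `|f x - f z| <= e / 4.
  by move=> uz zv; apply: hr; rewrite /ball_/= ltr_norml; lra.
have := near_x u (lexx _) uv; have := near_x v uv (lexx _); have := near_x t ut tv.
have -> : 2 * `|f t| = `|2 * f t| by rewrite normrM ger0_norm.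
move=> h1 h2 h3.
have -> : f v + f u = 2 * f t + ((f x - f t) + (f x - f t) - (f x - f v) - (f x - f u)) by ring.
apply: le_trans (ler_normD _ _) _; rewrite lerD2l.
by move: h1 h2 h3; rewrite !ler_norml; lra.
Qed.

(** One-sided limits handle 0 and 1; this is how the increment bound, proved inside []0, 1[],
    reaches the endpoints. *)
Lemma within_continuous_le (R : realType) (g : R -> R) (c : R) :
  {within `[0, 1], continuous g} -> (forall t, t \in `]0, 1[ -> g t <= c) ->
  forall t, t \in `[0, 1] -> g t <= c.
Proof.
move=> /(continuous_within_itvP _ ltr01)[_ g0 g1] gc t.
rewrite in_itv/= => /andP[]; rewrite le_eqVlt => /predU1P[<- _|t0].
  apply: (cvgr_to_le g0); near=> u; apply: gc; rewrite in_itv/=.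
  apply/andP; split; near: u; [exact: nbhs_right_gt|exact: nbhs_right_lt].
rewrite le_eqVlt => /predU1P[->|t1]; last by apply: gc; rewrite in_itv/= t0.
apply: (cvgr_to_le g1); near=> u; apply: gc; rewrite in_itv/=.
apply/andP; split; near: u; [exact: nbhs_left_gt|exact: nbhs_left_lt].
Unshelve. all: by end_near. Qed.

(** * The weights and Cauchy-Schwarz *)

Lemma powR_ge1 (R : realType) (x r : R) : 0 < x <= 1 -> r <= 0 -> 1 <= x `^ r.
Proof.
move=> /andP[x0 x1] r0; rewrite /powR gt_eqF//.
apply: le_trans (expR_ge1Dx _); rewrite lerDl.
by rewrite mulr_le0// ln_le0.
Qed.

Lemma kappa_ge0 (R : realType) (a b rho t : R) : 0 < rho -> 0 <= kappa a b rho t.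
Proof. by move=> r0; rewrite !mulr_ge0 ?powR_ge0// ltW. Qed.

Lemma kappat_ge0 (R : realType) (a b rho t : R) : 0 < rho -> 0 <= kappat a b rho t.
Proof. by move=> r0; rewrite !mulr_ge0 ?powR_ge0// invr_ge0 ltW. Qed.

(* The product is [a ^ (2 mu + 1) * (1 - a) ^ (2 ups + 1)] for
   [a = (1 - t) ^ rho], with both exponents nonpositive. *)
Lemma kappaM_ge1 (R : realType) (mu ups rho t : R) :
  0 < rho -> mu <= - 2^-1 -> ups <= - 2^-1 -> 0 < t < 1 ->
  1 <= kappa mu ups rho t * kappat mu ups rho t.
Proof.
move=> r0 hmu hups /andP[t0 t1]; rewrite /kappa /kappat.
have a0 : 0 < 1 - t by rewrite subr_gt0.
have a1 : 1 - t < 1 by rewrite gtrDl oppr_lt0.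
set a := 1 - t in a0 a1 *; pose c := 1 - a `^ rho; rewrite -/c.
have c0 : 0 < c.
  rewrite subr_gt0 /powR gt_eqF// expR_lt1 pmulr_rlt0//.
  by rewrite ln_lt0// a0.
have c1 : c <= 1 by rewrite gerDl oppr_le0 powR_ge0.
have -> : rho * a `^ (rho * (mu + 1) - 1) * c `^ ups *
    (rho^-1 * a `^ (rho * mu + 1) * c `^ (ups + 1)) =
    a `^ (rho * (2 * mu + 1)) * c `^ (2 * ups + 1).
  have -> : a `^ (rho * (2 * mu + 1)) =
      a `^ (rho * (mu + 1) - 1) * a `^ (rho * mu + 1).
    by rewrite -powRD ?(gt_eqF a0) ?implybT//; congr (_ `^ _); ring.
  have -> : c `^ (2 * ups + 1) = c `^ ups * c `^ (ups + 1).
    by rewrite -powRD ?(gt_eqF c0) ?implybT//; congr (_ `^ _); ring.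
  by field; rewrite gt_eqF.
have ha : 1 <= a `^ (rho * (2 * mu + 1)).
  apply: powR_ge1; first by rewrite a0 ltW.
  by rewrite pmulr_rle0//; lra.
have hc : 1 <= c `^ (2 * ups + 1) by apply: powR_ge1; [rewrite c0|lra].
by apply: (le_trans ha); rewrite ler_peMr// (le_trans _ ha).
Qed.

(** Absorbing the root of the weight and cutting off to []0, 1[] turns the weighted norm into a
    plain L2 norm on the line, the setting of [hoelder]. *)
Definition weighted (R : realType) (w f : R -> R) : R -> R :=
  (fun t => f t * w t `^ 2^-1) \_ `]0, 1[.

Lemma measurable_weighted (R : realType) (w f : R -> R) :
  measurable_fun (`]0, 1[ : set (measurableTypeR R)) f ->
  measurable_fun (`]0, 1[ : set (measurableTypeR R)) w ->
  measurable_fun [set: measurableTypeR R] (weighted w f).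
Proof.
move=> mf mw; apply/(measurable_restrictT _ _).1 => //.
by apply: measurable_funM => //; exact: (measurableT_comp (measurable_powR _) mw).
Qed.

Lemma wnorm_oo (R : realType) (w f : R -> R) :
  measurable_fun (`]0, 1[ : set (measurableTypeR R)) f ->
  measurable_fun (`]0, 1[ : set (measurableTypeR R)) w -> (forall t, 0 <= w t) ->
  wnorm w f = 'N[lebesgue_measure]_2%:E[EFin \o weighted w f]%E.
Proof.
move=> mf mw w0; rewrite unlock /wnorm; congr (_ `^ _)%E.
rewrite integral_itv_bndoo; last first.
  by apply/measurable_EFinP; apply: measurable_funM => //; exact: measurable_funX.
rewrite [LHS]integral_mkcond; apply: eq_integral => t _ /=.
rewrite powR_mulrn// real_normK ?num_real// /weighted !patchE.
case: ifPn => _; last by rewrite /point/= expr0n.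
by rewrite exprMn -[(_ `^ _) ^+ 2]powR_mulrn ?powR_ge0// -powRrM mulVf// powRr1.
Qed.

(** Since [(w * v) ^ (1/2) >= 1] on []0, 1[], inserting this factor only increases the integrand,
    which then splits into two weighted functions for Hoelder with exponents 2 and 2. *)
Lemma weighted_cauchy_schwarz (R : realType) (w v f g : R -> R) :
  measurable_fun (`]0, 1[ : set (measurableTypeR R)) f ->
  measurable_fun (`]0, 1[ : set (measurableTypeR R)) g ->
  measurable_fun (`]0, 1[ : set (measurableTypeR R)) w ->
  measurable_fun (`]0, 1[ : set (measurableTypeR R)) v ->
  (forall t, 0 <= w t) -> (forall t, 0 <= v t) ->
  (forall t, 0 < t < 1 -> 1 <= w t * v t) ->
  (\int[lebesgue_measure]_(t in `]0%R, 1%R[) (`|f t| * `|g t|)%:E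
     <= wnorm w f * wnorm v g)%E.
Proof.
move=> mf mg mw mv w0 v0 wv.
rewrite !wnorm_oo//.
apply: le_trans (hoelder lebesgue_measure (measurable_weighted mf mw)
  (measurable_weighted mg mv) _ _ _) => //; last first.
  lra.
rewrite Lnorm1 [leLHS]integral_mkcond; apply: ge0_le_integral => //.
- by move=> t _; apply: erestrict_ge0 => x _; rewrite lee_fin mulr_ge0.
- apply/(measurable_restrictT _ _).1 => //; apply/measurable_EFinP.
  by apply: measurable_funM; exact: measurableT_comp.
- apply: measurableT_comp => //; apply/measurable_EFinP; apply: measurable_funM; exact: measurable_weighted.
move=> t _ /=; rewrite /weighted !patchE; case: ifPn => // [|_]; last first.
  by rewrite mul0r normr0.
rewrite inE/= in_itv/= => t01; rewrite lee_fin.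
rewrite mulrACA -powRM// 2!normrM [`|_ `^ _|]ger0_norm ?powR_ge0//.
rewrite ler_peMr ?mulr_ge0//.
have : 1 `^ 2^-1 <= (w t * v t) `^ 2^-1.
  by rewrite ge0_ler_powR ?nnegrE ?mulr_ge0 ?wv.
by rewrite powR1.
Qed.

(** * The supremum bound *)

Theorem lemma4p2 (R : realType) (mu ups rho : R) (f df : R -> R) (xi : R)
  (hrho0 : 0 < rho) (hrho1 : rho <= 1)
  (hmu0 : -1 < mu) (hmu1 : mu <= - 2^-1)
  (hups0 : -1 < ups) (hups1 : ups <= - 2^-1)
  (hf : Brho mu ups rho f)
  (hdf : is_weak_derivative f df)
  (hxi : xi \in `[0, 1]) (hfxi : f xi = 0) :
  (supnorm f <= (Num.sqrt 2)%:E * wnorm (kappa mu ups rho) f `^ 2^-1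
                * wnorm (kappat mu ups rho) df `^ 2^-1)%E.
Proof.
have [cf _ _] := hf; have [[mf _ _] [mdf _ _] _] := hdf.
have mpow (p : R) (h : R -> R) : measurable_fun [set: measurableTypeR R] h ->
    measurable_fun [set: measurableTypeR R] (fun t => h t `^ p).
  by move=> mh; exact: (measurableT_comp (measurable_powR _) mh).
have m1 : measurable_fun [set: measurableTypeR R] (fun t : R => 1 - t).
  exact: measurable_funB.
have m2 : measurable_fun [set: measurableTypeR R] (fun t : R => 1 - (1 - t) `^ rho).
  by apply: measurable_funB => //; exact: mpow.
have := @weighted_cauchy_schwarz R (kappa mu ups rho) (kappat mu ups rho) f df mf mdf.
have mk : measurable_fun (`]0, 1[ : set (measurableTypeR R)) (kappa mu ups rho).
  apply: measurable_funTS; apply: measurable_funM; last exact: mpow.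
  by apply: measurable_funM => //; exact: mpow.
have mkt : measurable_fun (`]0, 1[ : set (measurableTypeR R)) (kappat mu ups rho).
  apply: measurable_funTS; apply: measurable_funM; last exact: mpow.
  by apply: measurable_funM => //; exact: mpow.
move=> /(_ mk mkt (fun=> kappa_ge0 _ _ _ hrho0) (fun=> kappat_ge0 _ _ _ hrho0)
  (fun t => kappaM_ge1 hrho0 hmu1 hups1)).
set I := (\int[_]_(_ in _) _)%E; set A := wnorm _ f; set B := wnorm _ df => CS.
have A0 : (0 <= A)%E by exact: poweR_ge0.
have B0 : (0 <= B)%E by exact: poweR_ge0.
have I0 : (0 <= I)%E by apply: integral_ge0 => t _; rewrite lee_fin mulr_ge0.
have f2I t : t \in `[0, 1] -> ((f t ^+ 2)%:E <= 2%:E * I)%E.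
  move=> t01.
  (* An infinite [I] makes the bound trivial; a finite one reduces it to real numbers. *)
  have [->|Iy] := eqVneq I +oo%E; first by rewrite mulry gtr0_sg// mul1e leey.
  have Ifin : I \is a fin_num by rewrite ge0_fin_numE// ltey.
  rewrite -(fineK Ifin) -EFinM lee_fin.
  have fab a b : a \in `]0, 1[ -> b \in `]0, 1[ -> a <= b ->
      `|f b ^+ 2 - f a ^+ 2| <= 2 * fine I.
    rewrite !in_itv/= => /andP[a0 _] /andP[_ b1] ab.
    have [ifdf sqi] := sqr_increment cf hdf a0 ab b1.
    apply: le_trans sqi _; rewrite ler_pM2l// fine_le//.
      exact: integrable_fin_num.
    apply: ge0_subset_integral => //.
    - apply/measurable_EFinP; apply: measurable_funM; exact: measurableT_comp.
    - by move=> s /=; rewrite !in_itv/= => /andP[? ?]; apply/andP; split; lra.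
  have fab' a b : a \in `]0, 1[ -> b \in `]0, 1[ -> f b ^+ 2 - f a ^+ 2 <= 2 * fine I.
    move=> a01 b01; apply: le_trans (ler_norm _) _.
    by have [ab|/ltW ba] := leP a b; [|rewrite distrC]; exact: fab.
  have cf2 : {within `[0, 1], continuous (fun x => f x ^+ 2)}.
    exact: (within_continuousM cf cf).
  have ccst c : {within `[0, 1], continuous (fun _ : R => c : R)}.
    by apply: continuous_subspaceT => x; exact: cvg_cst.
  (* The closed interval is reached one variable at a time: first [b], then [a], which becomes
     [xi]. *)
  have step1 a b : a \in `]0, 1[ -> b \in `[0, 1] -> f b ^+ 2 - f a ^+ 2 <= 2 * fine I.
    move=> a01; apply: (@within_continuous_le _ (fun b => f b ^+ 2 - f a ^+ 2)) => [|s].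
      exact: (within_continuousB cf2 (ccst _)).
    exact: fab'.
  have step2 : f t ^+ 2 - f xi ^+ 2 <= 2 * fine I.
    apply: (@within_continuous_le _ (fun a => f t ^+ 2 - f a ^+ 2)) hxi => [|s s01].
      exact: (within_continuousB (ccst _) cf2).
    exact: step1.
  by move: step2; rewrite hfxi expr0n subr0.
apply: ge_ereal_sup => _ [t t01 <-].
(* Both sides are written as powers [1/2], so that monotonicity leaves [f t ^+ 2 <= 2 * A * B],
   which follows from [f2I] and [CS]. *)
have -> : `|f t|%:E = ((f t ^+ 2)%:E `^ 2^-1)%E.
  by rewrite poweR_EFin powR12_sqrt ?sqr_ge0// sqrtr_sqr.
rewrite -powR12_sqrt// -poweR_EFin -poweRM//.
rewrite -poweRM//; last by rewrite mule_ge0.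
apply: gt0_ler_poweR.
- by rewrite invr_ge0.
- by rewrite in_itv/= lee_fin sqr_ge0 leey.
- by rewrite in_itv/= leey andbT !mule_ge0.
rewrite -muleA; apply: le_trans (f2I t t01) _.
by rewrite lee_pmul2l.
Qed.
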